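(* For each $d\in\{3,4,5,6\}$ there exist a sequence $(P_{d,M})_{M\ge 1}$ of polynomials of degree $d$ in $\mathbb{Z}[X]$ with $\mathrm{H}(P_{d,M})\to\infty$ as $M\to\infty$, a constant $C>0$ and an integer $M_0$ such that for all $M\ge M_0$ the polynomial $P_{d,M}$ has two complex roots $\alpha_M,\beta_M$ with $|\alpha_M|\neq|\beta_M|$ and $$\bigl||\alpha_M|-|\beta_M|\bigr|\le C\,\mathrm{H}(P_{d,M})^{-d-1}.$$
   Context: The height $\mathrm{H}(P)$ of a polynomial $P$ is the maximum of the absolute values of its coefficients. *)

(* Defs.v *)
From mathcomp Require Import all_boot all_order all_algebra.

Set Implicit Arguments.
Unset Strict Implicit.
Unset Printing Implicit Defensive.

(* Here [`|_|%N] is the absolute value [int -> nat]. *)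
Definition height (p : {poly int}) : nat :=
  \max_(i < size p) `|(p`_i)%R|%N.

(* Main.v *)
(** Idea. For d = 4 and d = 6, take P_M = M p + q, where p has the root 1 and
    the root i; q is chosen so that, as e = 1/M tends to 0, the moduli of the
    two roots of p + e q that start there have the same expansion up to order
    d, but not at order d + 1. With p anti-reciprocal and q reciprocal the even
    orders are automatic. For d = 5 the pencil y A - x B, with x^2 - 2 y^2 = 1,
    tends to a quintic over Q(sqrt 2) at distance about y^-2, and the moduli of
    two pairs of complex roots agree up to order 2 only. In these three cases
    the quadratic factors X^2 - S X + T of the limit are continued as truncated
    power series in e with integer coefficients: if z is a root of such a
    factor then |z|^2 = T, and the squared moduli of the values of P_M and P_M'
    at z are polynomials in e, so that everything reduces to the exact orders of
    vanishing of explicit integer polynomials.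

    For d = 3, a root r and a conjugate pair of modulus |r| force r = - c / b
    in the cubic a X^3 + b X^2 + c X + d, and the value there is
    (d b^3 - a c^3) / b^3. With a = 8 x - 4 y, b = x, c = y, d = x + 4 y the
    numerator is (x^2 + 2 x y - 2 y^2)^2, a Pell form that is equal to 1
    infinitely often. *)

From Stdlib Require Import BinInt.
Require Import Defs.
From mathcomp Require Import all_boot all_order all_algebra complex.
From mathcomp Require Import classical_sets reals topology.
From mathcomp Require Import ssrZ zify ring lra.

Set Implicit Arguments.
Unset Strict Implicit.
Unset Printing Implicit Defensive.

Import Order.TTheory GRing.Theory Num.Theory.

Local Open Scope classical_set_scope.
Local Open Scope ring_scope.
Delimit Scope Z_scope with ZZ.

(** * Locating a root near an approximate one *)

(** The logarithmic derivative is the sum of the [1 / (z - r)], each at most [1 / rho] in modulus;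
    the product form avoids division when [rho] or a factor is zero. *)
Lemma deriv_prod_XsubC_le (C : numClosedFieldType) (rs : seq C) (z rho : C) :
  {in rs, forall r, rho <= `|z - r|} -> 0 <= rho ->
  let p := \prod_(r <- rs) ('X - r%:P) in
  rho * `|p^`().[z]| <= `|p.[z]| *+ size rs.
Proof.
move=> + rho0 /=; elim: rs => [|r rs IH] hrs.
  by rewrite big_nil -polyC1 derivC horner0 normr0 mulr0.
rewrite big_cons derivM derivXsubC mul1r !hornerE normrM mulrS.
set q := \prod_(j <- rs) _ in IH *.
have hr : rho <= `|z - r| by apply: hrs; rewrite mem_head.
have {}IH : rho * `|q^`().[z]| <= `|q.[z]| *+ size rs.
  by apply: IH => s hs; apply: hrs; rewrite in_cons hs orbT.
apply: (@le_trans _ _ (rho * (`|q.[z]| + `|z - r| * `|q^`().[z]|))).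
  by rewrite ler_wpM2l // -normrM ler_normD.
rewrite mulrDr lerD ?ler_wpM2r // mulrCA -mulrnAr.
exact: ler_wpM2l.
Qed.

(** If every root were farther from [z] than [rho = size p * |p(z)| / |p'(z)|], the bound on the
    derivative would give [size p <= size p - 1], as there are only [size p - 1] roots. *)
Lemma root_near (C : numClosedFieldType) (p : {poly C}) (z : C) :
  p^`().[z] != 0 ->
  exists2 r, root p r & `|p^`().[z]| * `|z - r| <= `|p.[z]| *+ size p.
Proof.
move=> dp0; have [pz|npz] := boolP (root p z).
  by exists z => //; rewrite subrr normr0 mulr0 mulrn_wge0.
have p0 : p != 0 by apply: contraNneq npz => ->; rewrite root0.
have [rs prs] := closed_field_poly_normal p.
have szp : size p = (size rs).+1.
  by rewrite prs size_scale ?lead_coef_eq0 // size_prod_XsubC.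
set d := `|p^`().[z]|; have d_gt0 : 0 < d by rewrite normr_gt0.
have v_gt0 : 0 < `|p.[z]| by rewrite normr_gt0.
pose rho := d^-1 * (`|p.[z]| *+ size p).
have rho0 : 0 <= rho by rewrite mulr_ge0 ?invr_ge0 ?mulrn_wge0 // ltW.
have [/hasP[r rrs hr]|/hasPn hrs] := boolP (has (fun r => `|z - r| <= rho) rs).
  exists r; last by rewrite -ler_pdivlMl.
  by rewrite prs rootZ ?lead_coef_eq0 // root_prod_XsubC.
have {hrs} : {in rs, forall r, rho <= `|z - r|}.
  move=> r /hrs; rewrite -real_ltNge ?ger0_real //; exact: ltW.
move/deriv_prod_XsubC_le => /(_ rho0) /=; set q := \prod_(r <- rs) _ => hq.
have : rho * d <= `|p.[z]| *+ size rs.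
  rewrite /d prs derivZ !hornerZ !normrM mulrCA -mulrnAr.
  exact: ler_wpM2l.
by rewrite /rho mulrAC mulVf ?gt_eqF // mul1r szp ler_pMn2l // ltnn.
Qed.

(** * Exact arithmetic of integer polynomials in [e] *)

Section IntegerPolynomials.
Variable R : rcfType.
Implicit Types (e : R) (s t : seq Z) (P : seq (seq Z)).

Definition zr (z : Z) : R := (int_of_Z z)%:~R.

Lemma zrD x y : zr (x + y)%ZZ = zr x + zr y.
Proof. by rewrite /zr -[(x + y)%ZZ]/(x + y) !rmorphD. Qed.

Lemma zrM x y : zr (x * y)%ZZ = zr x * zr y.
Proof. by rewrite /zr -[(x * y)%ZZ]/(x * y) !rmorphM. Qed.

(* Exact arithmetic on coefficient lists in the variable [e], constant term
   first, over [Z] because [int] is unary and does not compute. *)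
Fixpoint peval e s : R := if s is c :: s' then zr c + e * peval e s' else 0.

Fixpoint padd s t : seq Z :=
  match s, t with
  | [::], _ => t
  | _, [::] => s
  | a :: s', b :: t' => (a + b)%ZZ :: padd s' t'
  end.

Definition pscale (a : Z) s : seq Z := map (Z.mul a) s.

Fixpoint pmul s t : seq Z :=
  if s is a :: s' then padd (pscale a t) (0%ZZ :: pmul s' t) else [::].

Lemma peval_add e s t : peval e (padd s t) = peval e s + peval e t.
Proof.
elim: s t => [|a s IH] [|b t] /=; rewrite ?add0r ?addr0 //.
by rewrite IH zrD; ring.
Qed.

Lemma peval_scale e a s : peval e (pscale a s) = zr a * peval e s.
Proof. by elim: s => [|b s /= ->]; rewrite ?mulr0 // zrM; ring. Qed.

Lemma peval_mul e s t : peval e (pmul s t) = peval e s * peval e t.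
Proof.
elim: s => [|a s IH]; first by rewrite mul0r.
rewrite [pmul _ _]/= peval_add peval_scale /= IH.
rewrite -[zr 0]/(0 : R); ring.
Qed.

Definition coef_norm s : R := \sum_(c <- s) `|zr c|.

(** Divisibility by [e ^+ k]; a list shorter than [k] passes only if all its entries are zero, so
    [k = size s] tests for the zero polynomial. *)
Definition vanishes (k : nat) s := all (Z.eqb 0) (take k s).

Lemma coef_norm_ge0 s : 0 <= coef_norm s.
Proof. exact: sumr_ge0. Qed.

Lemma coef_norm_drop k s : coef_norm (drop k s) <= coef_norm s.
Proof.
rewrite -[in leRHS](cat_take_drop k s) /coef_norm big_cat /= lerDr.
exact: sumr_ge0.
Qed.

Lemma coef_norm_nth k s : nth 0%ZZ s k <> 0%ZZ -> 1 <= coef_norm s.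
Proof.
move=> hk; apply: le_trans (coef_norm_drop k s).
have ks : (k < size s)%N.
  by rewrite ltnNge; apply/negP => /(nth_default 0%ZZ).
rewrite (drop_nth 0%ZZ ks) /coef_norm big_cons.
apply: (@le_trans _ _ `|zr (nth 0%ZZ s k)|); last first.
  by rewrite lerDl; apply: sumr_ge0.
rewrite /zr -intr_norm -[1]/(1%:~R) ler_int.
have : int_of_Z (nth 0%ZZ s k) != 0.
  apply/eqP => h; apply: hk.
  by rewrite -[LHS]int_of_ZK h.
lia.
Qed.

Lemma peval_le e s : 0 <= e -> e <= 1 -> `|peval e s| <= coef_norm s.
Proof.
move=> e0 e1; elim: s => [|c s IH] /=; first by rewrite normr0 /coef_norm big_nil.
rewrite /coef_norm big_cons; apply: le_trans (ler_normD _ _) _; rewrite lerD2l.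
by rewrite normrM (ger0_norm e0); apply: le_trans IH; rewrite ler_piMl.
Qed.

Lemma peval_vanishes e k s :
  vanishes k s -> peval e s = e ^+ k * peval e (drop k s).
Proof.
rewrite /vanishes.
elim: k s => [|k IH] [|c s] /=; rewrite ?mulr0 ?expr0 ?mul1r //.
by case: c => // /IH ->; rewrite -[zr 0]/(0 : R) exprS; ring.
Qed.

Lemma peval_vanishes_le e k s : 0 <= e -> e <= 1 ->
  vanishes k s -> `|peval e s| <= coef_norm s * e ^+ k.
Proof.
move=> e0 e1 /(peval_vanishes e) ->.
rewrite normrM mulrC (ger0_norm (exprn_ge0 _ e0)).
rewrite ler_wpM2r ?exprn_ge0 //; apply: le_trans (coef_norm_drop k s).
exact: peval_le.
Qed.

Lemma peval_head_near e c s : 0 <= e -> e * (2 * coef_norm (c :: s)) <= 1 ->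
  c <> 0%ZZ -> `|peval e (c :: s) - zr c| <= 2^-1.
Proof.
move=> e0 eK c0 /=; rewrite addrAC subrr add0r normrM ger0_norm //.
(* A nonzero constant term makes the norm at least 1, so the smallness hypothesis also gives
   [e <= 1]. *)
have s1 := @coef_norm_nth 0 (c :: s) c0.
have e1 : e <= 1 by nra.
have := peval_le s e0 e1; have := coef_norm_drop 1 (c :: s); rewrite drop1 /=.
nra.
Qed.

Lemma zr_ge1 c : (0 < c)%ZZ -> 1 <= zr c.
Proof. by move=> c0; rewrite /zr -[1]/(1%:~R) ler_int; lia. Qed.

Lemma zr_norm_ge1 c : c <> 0%ZZ -> 1 <= `|zr c|.
Proof.
by move=> c0; have := @coef_norm_nth 0 [:: c] c0; rewrite /coef_norm big_seq1.
Qed.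

Lemma peval_head_gt0 e s : 0 <= e -> e * (2 * coef_norm s) <= 1 ->
  (0 < head 0 s)%ZZ -> 2^-1 <= peval e s.
Proof.
case: s => [|c s] // e0 eK c0.
have c0' : c <> 0%ZZ by move=> h; rewrite h in c0.
have := peval_head_near e0 eK c0'; have := zr_ge1 c0.
by rewrite ler_norml => ? /andP[]; lra.
Qed.

(** Once [e ^+ k] is factored out, a nonzero integer constant term remains, and the tail moves it by
    at most 1/2. *)
Lemma peval_vanishes_ge e k s : 0 <= e -> e * (2 * coef_norm s) <= 1 ->
  vanishes k s -> nth 0%ZZ s k <> 0%ZZ -> 2^-1 * e ^+ k <= `|peval e s|.
Proof.
move=> e0 eK /(peval_vanishes e) -> sk.
rewrite normrM mulrC (ger0_norm (exprn_ge0 _ e0)) ler_wpM2l ?exprn_ge0 //.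
have ks : (k < size s)%N.
  by rewrite ltnNge; apply/negP => /(nth_default 0%ZZ).
have eK' : e * (2 * coef_norm (drop k s)) <= 1.
  by apply: le_trans eK; rewrite !ler_wpM2l // coef_norm_drop.
rewrite (drop_nth 0%ZZ ks) in eK' *.
have := peval_head_near e0 eK' sk; have := zr_norm_ge1 sk.
set x := zr _; set y := peval _ _ => hx hy.
have := ler_normB y (y - x); rewrite opprB addrC subrK; lra.
Qed.

(** * Arithmetic modulo [z ^+ 2 - S z + T] *)

(* [(u, v)] stands for [u + v z], where [z ^+ 2 = S z - T]. *)
Definition qshift (S T : seq Z) (w : seq Z * seq Z) : seq Z * seq Z :=
  (pscale (-1) (pmul T w.2), padd w.1 (pmul S w.2)).

Definition qadd (w w' : seq Z * seq Z) := (padd w.1 w'.1, padd w.2 w'.2).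

Fixpoint qeval (S T : seq Z) P : seq Z * seq Z :=
  if P is c :: P' then qadd (c, [::]) (qshift S T (qeval S T P'))
  else ([::], [::]).

(** The Horner scheme differentiated: [(c + X P)' = P + X P']. *)
Fixpoint qderiv (S T : seq Z) P : seq Z * seq Z :=
  if P is c :: P' then qadd (qeval S T P') (qshift S T (qderiv S T P'))
  else ([::], [::]).

(** The norm form [(u + v z) (u + v z')], where [z + z' = S] and [z z' = T]. *)
Definition qnorm (S T : seq Z) (w : seq Z * seq Z) : seq Z :=
  padd (padd (pmul w.1 w.1) (pmul S (pmul w.1 w.2))) (pmul T (pmul w.2 w.2)).

(* [P] lists the coefficients of the powers of ['X], each a polynomial in [e]. *)
Definition specialize e P : {poly R[i]} :=
  Poly [seq (peval e c)%:C%C | c <- P].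

Section Quadratic.
Variables (e : R) (S T : seq Z) (z : R[i]).
Hypothesis zDJ : z + z^*%C = (peval e S)%:C%C.
Hypothesis zMJ : z * z^*%C = (peval e T)%:C%C.

Definition qval (w : seq Z * seq Z) : R[i] :=
  (peval e w.1)%:C%C + (peval e w.2)%:C%C * z.

Lemma qval_add w w' : qval (qadd w w') = qval w + qval w'.
Proof. by rewrite /qval /= !peval_add !rmorphD /=; ring. Qed.

Lemma qval_shift w : qval (qshift S T w) = qval w * z.
Proof.
rewrite /qval /= peval_scale peval_add !peval_mul.
rewrite -[zr (-1)]/(-1 : R) !(rmorphD, rmorphM, rmorphN, rmorph1) /= -zDJ -zMJ.
ring.
Qed.

Lemma qval_eval P : qval (qeval S T P) = (specialize e P).[z].
Proof.
elim: P => [|c P IH]; first by rewrite /qval /= mul0r addr0 horner0.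
rewrite [qeval _ _ _]/= qval_add qval_shift IH /specialize /= horner_cons addrC.
by rewrite /qval /= mul0r addr0.
Qed.

Lemma qval_deriv P : qval (qderiv S T P) = (specialize e P)^`().[z].
Proof.
elim: P => [|c P IH]; first by rewrite /qval /= mul0r addr0 derivC horner0.
rewrite [qderiv _ _ _]/= qval_add qval_shift IH qval_eval /specialize /=.
by rewrite cons_poly_def derivMXaddC hornerD hornerMX.
Qed.

Lemma norm_qval w : `|qval w| ^+ 2 = (peval e (qnorm S T w))%:C%C.
Proof.
rewrite sqr_normc /qval /qnorm.
have -> (u v : R) : (u%:C%C + v%:C%C * z)^*%C = u%:C%C + v%:C%C * z^*%C.
  by rewrite rmorphD rmorphM; congr (_ + _ * _); apply: conjc_real.
rewrite !peval_add !peval_mul !(rmorphD, rmorphM) /= -zDJ -zMJ.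
ring.
Qed.

End Quadratic.

End IntegerPolynomials.

(** * From truncated quadratic factors to true roots *)

Section Approximants.
Variable R : rcfType.
Implicit Types (e : R) (S T : seq Z) (P : seq (seq Z)).

(** Real-valued, because [R[i]] is only partially ordered and the estimates need a total order. *)
Definition modulus (z : R[i]) : R := Normc.normc z.

Lemma modulusE z : `|z| = (modulus z)%:C%C.
Proof. by []. Qed.

Lemma modulus_ge0 z : 0 <= modulus z.
Proof. by rewrite -ler0c -modulusE. Qed.

Lemma modulus_dist (z w : R[i]) : `|modulus z - modulus w| <= modulus (z - w).
Proof.
have H (x y : R[i]) : modulus x - modulus y <= modulus (x - y).
  rewrite -lecR rmorphB /= -!modulusE lerBlDr -[in leLHS](subrK y x).
  exact: ler_normD.
rewrite ler_norml H andbT lerNl opprB; apply: le_trans (H _ _) _.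
by rewrite -lecR -!modulusE distrC.
Qed.

(** The roots of [X^2 - s X + t] are [s / 2] plus or minus [i sqrt (t - s^2 / 4)]; for [s^2 = 4 t]
    they are real and equal, so real roots are covered too. *)
Lemma conj_pair (s t : R) : s ^+ 2 <= 4 * t ->
  exists z : R[i], z + z^*%C = s%:C%C /\ z * z^*%C = t%:C%C.
Proof.
move=> st; pose y := Num.sqrt (t - (s / 2) ^+ 2).
have y2 : y ^+ 2 = t - (s / 2) ^+ 2 by rewrite sqr_sqrtr //; lra.
exists (s / 2 +i* y)%C; split; apply/eqP; rewrite eq_complex /=.
  by apply/andP; split; apply/eqP; lra.
by apply/andP; split; apply/eqP; lra.
Qed.

(* Up to [O (e ^+ m)], the complex [z] with trace [S] and norm [T] is a simple
   root of the member [e] of the family [P]; the last clause makes [S ^+ 2 <= 4 T]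
   for small [e >= 0], so that such a [z] exists. *)
Definition approximates P (m : nat) S T : bool :=
  let D := padd (pscale 4%ZZ T) (pscale (-1)%ZZ (pmul S S)) in
  [&& vanishes m.*2 (qnorm S T (qeval S T P)),
      Z.ltb 0 (head 0%ZZ (qnorm S T (qderiv S T P)))
    & vanishes (size D) D || Z.ltb 0 (head 0%ZZ D)].

(** [|p(z)|^2] vanishes to order [2 m], so [|p(z)|] is [O(e ^+ m)], while [|p'(z)|] stays at least
    1/2; hence a true root lies within [O(e ^+ m)] of [z], whose modulus is the square root of
    [T]. *)
Lemma root_near_approximant P m S T : approximates P m S T ->
  exists2 K : R, 0 < K & forall e, 0 < e -> e * K <= 1 ->
    exists2 r, root (specialize e P) r &
      `|modulus r - Num.sqrt (peval e T)| <= K * e ^+ m.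
Proof.
case/and3P; set D := padd _ _; set N := qnorm _ _ _; set N' := qnorm _ _ _.
move=> Nm /Z.ltb_lt N'0 D0.
pose n : R := (size P)%:R; have n0 : 0 <= n by rewrite ler0n.
have N_ge0 := coef_norm_ge0 R N; have N'_ge0 := coef_norm_ge0 R N'.
have D_ge0 := coef_norm_ge0 R D.
pose B := 1 + coef_norm R N + coef_norm R N' + coef_norm R D.
(* The constant both forces [e] to be small and bounds the error: 2 comes from [|p'(z)| >= 1/2], [n]
   from the size of the polynomial, [B] from the coefficients. *)
exists (2 * (1 + n) * B) => [|e e0 eK]; first by rewrite /B; nra.
have eB : e * (2 * B) <= 1 by rewrite /B in eK *; nra.
have e1 : e <= 1 by rewrite /B in eB; nra.
have e0' := ltW e0.
have De : peval e S ^+ 2 <= 4 * peval e T.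
  have : 0 <= peval e D.
    (* Either [4 T - S ^+ 2] is the zero polynomial, the case of a real root, or its constant term
       is positive. *)
    case/orP: D0 => [/(peval_vanishes e) ->|/Z.ltb_lt D0].
      by rewrite drop_size mulr0.
    apply: le_trans (peval_head_gt0 e0' _ D0); rewrite ?invr_ge0 //.
    by rewrite /B in eB; nra.
  rewrite /D peval_add !peval_scale peval_mul.
  by rewrite -[zr R 4]/(4 : R) -[zr R (-1)]/(-1 : R); lra.
have [z [zD zM]] := conj_pair De.
have pz : modulus (specialize e P).[z] <= (1 + coef_norm R N) * e ^+ m.
  have h : modulus (specialize e P).[z] ^+ 2 = peval e N.
    by apply: complexI; rewrite rmorphXn /= -modulusE -(qval_eval zD zM)
      (norm_qval zD zM).
  have em : 0 <= e ^+ m by rewrite exprn_ge0.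
  rewrite -(ler_sqr (modulus_ge0 _)) ?nnegrE ?mulr_ge0 ?addr_ge0 // h.
  have := peval_vanishes_le e0' e1 Nm; rewrite -muln2 exprM.
  by have := ler_norm (peval e N); nra.
have dpz : 2^-1 <= modulus (specialize e P)^`().[z].
  have h : modulus (specialize e P)^`().[z] ^+ 2 = peval e N'.
    by apply: complexI; rewrite rmorphXn /= -modulusE -(qval_deriv zD zM)
      (norm_qval zD zM).
  have := modulus_ge0 (specialize e P)^`().[z].
  have := peval_head_gt0 e0' _ N'0; rewrite -h => /(_ _)/wrap[].
    by rewrite /B in eB; nra.
  by nra.
have zT : modulus z = Num.sqrt (peval e T).
  have <- : modulus z ^+ 2 = peval e T.
    by apply: complexI; rewrite rmorphXn /= -modulusE sqr_normc.
  by rewrite sqrtr_sqr ger0_norm ?modulus_ge0.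
have [|r rr hr] := @root_near _ (specialize e P) z.
  by rewrite -normr_gt0 modulusE ltcR; apply: lt_le_trans dpz; rewrite invr_gt0.
exists r => //; rewrite -zT distrC; apply: le_trans (modulus_dist _ _) _.
have {}hr : modulus (specialize e P)^`().[z] * modulus (z - r) <=
    n * modulus (specialize e P).[z].
  rewrite -lecR !rmorphM /= -!modulusE; apply: le_trans hr _.
  rewrite -[leLHS]mulr_natl rmorph_nat ler_wpM2r // ler_nat.
  by rewrite -[leqRHS](size_map (fun c => (peval e c)%:C%C)) size_Poly.
have em : 0 <= e ^+ m by rewrite exprn_ge0.
have := ler_wpM2r (modulus_ge0 (z - r)) dpz; have := ler_wpM2l n0 pz.
have : 0 <= n * (coef_norm R N' + coef_norm R D) * e ^+ m.
  by rewrite !mulr_ge0 ?addr_ge0.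
have : 0 <= B * e ^+ m by rewrite mulr_ge0 // /B; lra.
by rewrite /B; lra.
Qed.

End Approximants.

(** The true moduli are within [O(e ^+ m.+1)] of the square roots of [T1] and [T2], whose difference
    has exact order [m]; for small [e] the errors cannot cancel it. *)
Lemma close_moduli (R : rcfType) (P : seq (seq Z)) (m : nat) (S1 T1 S2 T2 : seq Z) :
  let D := padd T1 (pscale (-1)%ZZ T2) in
  [&& approximates P m.+1 S1 T1, approximates P m.+1 S2 T2,
      Z.ltb 0 (head 0%ZZ T1), Z.ltb 0 (head 0%ZZ T2),
      vanishes m D & ~~ Z.eqb (nth 0%ZZ D m) 0] ->
  exists2 K : R, 0 < K & forall e : R, 0 < e -> e * K <= 1 ->
    exists alpha beta : R[i],
      [/\ root (specialize e P) alpha, root (specialize e P) beta,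
          modulus alpha != modulus beta
        & `|modulus alpha - modulus beta| <= K * e ^+ m].
Proof.
move=> D /and5P[A1 A2 /Z.ltb_lt T10 /Z.ltb_lt T20 /andP[Dm /negP Dm0]].
have {}Dm0 : nth 0%ZZ D m <> 0%ZZ by move=> h; apply: Dm0; rewrite h.
have [K1 K1_gt0 H1] := root_near_approximant R A1.
have [K2 K2_gt0 H2] := root_near_approximant R A2.
have D_ge0 := coef_norm_ge0 R D.
have B1_ge0 := coef_norm_ge0 R T1; have B2_ge0 := coef_norm_ge0 R T2.
set d := coef_norm R D in D_ge0 *; set b1 := coef_norm R T1 in B1_ge0 *.
set b2 := coef_norm R T2 in B2_ge0 *.
(* [L] bounds the sum of the two square roots, so they differ by at least [e ^+ m / (2 L)]; the term
   [4 L (1 + K1 + K2)] keeps the error below [e ^+ m / (4 L)]. *)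
pose L := 2 + b1 + b2; pose K := 1 + 4 * L * (1 + K1 + K2) + 2 * d.
have KL : 0 <= (K1 + K2) * (b1 + b2) by rewrite mulr_ge0; lra.
have K_ge : 1 + 8 * (1 + K1 + K2) + 4 * (b1 + b2) + 2 * d <= K.
  by rewrite /K /L; lra.
exists K => [|e e0 eK]; first lra.
have e0' := ltW e0.
have eK_le x : x <= K -> e * x <= 1.
  by move=> xK; apply: le_trans eK; rewrite ler_wpM2l.
have e1 : e <= 1 by rewrite -[e]mulr1; apply: eK_le; lra.
have [alpha ra ha] := H1 e e0 (eK_le K1 ltac:(lra)).
have [beta rb hb] := H2 e e0 (eK_le K2 ltac:(lra)).
exists alpha, beta.
have t1 := peval_head_gt0 e0' (eK_le (2 * b1) ltac:(lra)) T10.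
have t2 := peval_head_gt0 e0' (eK_le (2 * b2) ltac:(lra)) T20.
have D_hi := peval_vanishes_le e0' e1 Dm.
have D_lo := peval_vanishes_ge e0' (eK_le (2 * d) ltac:(lra)) Dm Dm0.
have := peval_le T1 e0' e1; have := peval_le T2 e0' e1.
move: D_hi D_lo; rewrite /D peval_add peval_scale -[zr R (-1)]/(-1 : R) mulN1r.
move=> D_hi D_lo /(le_trans (ler_norm _)) T2_hi /(le_trans (ler_norm _)) T1_hi.
move: ha hb t1 t2 D_hi D_lo T1_hi T2_hi; rewrite -/d -/b1 -/b2 exprS.
have : 0 < e ^+ m by rewrite exprn_gt0.
set x := e ^+ m; set u1 := peval e T1; set u2 := peval e T2 => x0 ha hb t1 t2.
have s1 : Num.sqrt u1 ^+ 2 = u1 by rewrite sqr_sqrtr //; lra.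
have s2 : Num.sqrt u2 ^+ 2 = u2 by rewrite sqr_sqrtr //; lra.
move: s1 s2 ha hb (sqrtr_ge0 u1) (sqrtr_ge0 u2).
set v1 := Num.sqrt u1; set v2 := Num.sqrt u2 => s1 s2 ha hb v1_ge0 v2_ge0.
have v1_ge : 2^-1 <= v1 by nra.
have v2_ge : 2^-1 <= v2 by nra.
move=> D_hi D_lo T1_hi T2_hi; clearbody x v1 v2 u1 u2 d b1 b2.
have v_le : v1 + v2 <= L by rewrite /L; nra.
have dv : `|u1 - u2| = `|v1 - v2| * (v1 + v2).
  by rewrite -s1 -s2 subr_sqr normrM (ger0_norm (addr_ge0 v1_ge0 v2_ge0)).
have dv_hi : `|v1 - v2| <= d * x.
  by apply: le_trans D_hi; rewrite dv ler_peMr //; lra.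
have dv_lo : x <= `|v1 - v2| * L * 2.
  by rewrite dv in D_lo; have := ler_wpM2l (normr_ge0 (v1 - v2)) v_le; lra.
have err : `|(modulus alpha - modulus beta) - (v1 - v2)| <= (K1 + K2) * (e * x).
  rewrite [X in `|X|](_ : _ = (modulus alpha - v1) - (modulus beta - v2)); last ring.
  by apply: le_trans (ler_normB _ _) _; lra.
split=> //; last first.
  rewrite -[modulus alpha - _](subrK (v1 - v2)).
  apply: le_trans (ler_normD _ _) _; apply: le_trans (lerD err dv_hi) _.
  have : (K1 + K2) * (e * x) <= (K1 + K2) * x.
    by rewrite ler_wpM2l ?ler_piMl //; lra.
  have : 0 <= (K - (K1 + K2) - d) * x by rewrite mulr_ge0 //; lra.
  lra.
apply/eqP => ab; move: err; rewrite ab subrr add0r normrN => err.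
have h1 : `|v1 - v2| * L * 2 <= (K1 + K2) * (e * x) * L * 2.
  by rewrite !ler_wpM2r // /L; lra.
have h2 : e * (4 * L * (1 + K1 + K2)) <= 1 by apply: eK_le; rewrite /K; lra.
have h3 : 0 <= e * (4 * L) * x by rewrite !mulr_ge0 // /L; lra.
have h4 := ler_wpM2r (ltW x0) h2.
clear -x0 dv_lo h1 h3 h4; lra.
Qed.

(** * Heights and families of polynomials *)

Lemma modulus_real (R : rcfType) (x : R) : modulus x%:C%C = `|x|.
Proof. by rewrite /modulus /= expr0n addr0 sqrtr_sqr. Qed.

Lemma height_Poly_le (s : seq int) (B : nat) :
  all (fun c => `|c|%N <= B)%N s -> (height (Poly s) <= B)%N.
Proof.
move/allP => sB; apply/bigmax_leqP => i _; rewrite coef_Poly.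
have [si|si] := ltnP i (size s); first by apply: sB; rewrite mem_nth.
by rewrite nth_default.
Qed.

Lemma coef_le_height (p : {poly int}) (i : nat) : (`|(p`_i)%R| <= height p)%N.
Proof.
have [pi|pi] := ltnP i (size p); last by rewrite nth_default.
exact: (leq_bigmax (Ordinal pi)).
Qed.

Definition close_moduli_family (R : realType) (d : nat) : Prop :=
  exists (P : nat -> {poly int}) (C : R) (M0 : nat),
    [/\ forall M : nat, (1 <= M)%N -> size (P M) = d.+1,
        height (P M) @[M --> \oo] --> \oo,
        0 < C,
        (1 <= M0)%N
      & forall M : nat, (M0 <= M)%N ->
          exists alpha beta : R[i],
            [/\ root (map_poly intr (P M)) alpha,
                root (map_poly intr (P M)) beta,
                `|alpha| != `|beta|
              & `| `|alpha| - `|beta| |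
                  <= (C * (height (P M))%:R ^- d.+1)%:C%C]].

(** [h M] is a convenient stand-in for the height: replacing it multiplies the constant by
    [B ^+ d.+1]. *)
Lemma height_family (R : realType) (d : nat) (P : nat -> {poly int})
    (h : nat -> nat) (B : nat) (K : R) (M0 : nat) :
  (forall M, (1 <= M)%N -> size (P M) = d.+1) ->
  (forall M, M <= height (P M))%N ->
  (forall M, (1 <= M)%N -> height (P M) <= B * h M)%N ->
  0 < K -> (1 <= M0)%N ->
  (forall M, (M0 <= M)%N -> exists alpha beta : R[i],
     [/\ root (map_poly intr (P M)) alpha, root (map_poly intr (P M)) beta,
         modulus alpha != modulus beta
       & `|modulus alpha - modulus beta| <= K * (h M)%:R ^- d.+1]) ->
  close_moduli_family R d.
Proof.
move=> szP MP PB K0 M01 roots.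
have B_gt0 : (0 < B)%N.
  rewrite lt0n; apply/eqP => B0; have := leq_trans (MP 1%N) (PB 1%N isT).
  by rewrite B0.
exists P, (K * B%:R ^+ d.+1), M0; split=> //.
- by apply/cvgnyPge => A; exists A => // M /= AM; apply: leq_trans AM _.
- by rewrite mulr_gt0 // exprn_gt0 // ltr0n.
move=> M M0M; have [alpha [beta [ra rb ab le_ab]]] := roots M M0M.
exists alpha, beta; split=> //; first by rewrite !modulusE (inj_eq (@complexI R)).
rewrite !modulusE -rmorphB modulus_real lecR.
apply: le_trans le_ab _; rewrite -mulrA ler_wpM2l ?(ltW K0) //.
have M1 := leq_trans M01 M0M.
have HM : (0 < height (P M))%N := leq_trans M1 (MP M).
have hM : (0 < h M)%N.
  by have := leq_trans HM (PB M M1); rewrite muln_gt0 => /andP[].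
rewrite ler_pdivlMr ?exprn_gt0 ?ltr0n // mulrC ler_pdivrMr ?exprn_gt0 ?ltr0n //.
by rewrite -exprMn -natrM lerXn2r ?nnegrE ?ler_nat ?PB.
Qed.

Definition pencil (p q : seq Z) (M : nat) : {poly int} :=
  Poly [seq M%:Z * int_of_Z c.1 + int_of_Z c.2 | c <- zip p q].

Lemma map_pencil (R : rcfType) (p q : seq Z) (M : nat) : (0 < M)%N ->
  map_poly intr (pencil p q M) =
  M%:R *: specialize (M%:R^-1 : R) [seq [:: c.1; c.2] | c <- zip p q].
Proof.
move=> M0; have M0' : M%:R != 0 :> R by rewrite pnatr_eq0 -lt0n.
apply/polyP => i; rewrite coef_map coefZ !coef_Poly -map_comp.
have [iz|iz] := ltnP i (size (zip p q)); last first.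
  by rewrite !nth_default ?size_map // mulr0.
rewrite !(nth_map (0%ZZ, 0%ZZ)) //; case: (nth _ _ _) => a b.
transitivity (M%:R * (zr R a + M%:R^-1 * zr R b))%:C%C.
  rewrite mulrDr mulVKf // /zr -[M%:R]/(M%:Z%:~R) -intrM -intrD.
  by rewrite (rmorph_int (real_complex R)).
by rewrite rmorphM rmorph_nat /= mulr0 addr0.
Qed.

(** With [e = 1 / M] the height is comparable to [M], so a gap of exact order [d + 1] in [e] is the
    required one. *)
Lemma pencil_family (R : realType) (d : nat) (p q : seq Z)
    (S1 T1 S2 T2 : seq Z) :
  let P := [seq [:: c.1; c.2] | c <- zip p q] in
  let D := padd T1 (pscale (-1)%ZZ T2) in
  [&& approximates P d.+2 S1 T1, approximates P d.+2 S2 T2,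
      Z.ltb 0 (head 0%ZZ T1), Z.ltb 0 (head 0%ZZ T2),
      vanishes d.+1 D & ~~ Z.eqb (nth 0%ZZ D d.+1) 0] ->
  size p = d.+1 -> size q = d.+1 ->
  Z.ltb 0 (last 0%ZZ p) -> Z.ltb 0 (last 0%ZZ q) ->
  close_moduli_family R d.
Proof.
move=> P D /close_moduli-/(_ R)[K K0 HK] sp sq /Z.ltb_lt p0 /Z.ltb_lt q0.
have szz : size (zip p q) = d.+1 by rewrite size_zip sp sq minnn.
pose f M := fun c : Z * Z => M%:Z * int_of_Z c.1 + int_of_Z c.2.
have fd M : nth 0 [seq f M c | c <- zip p q] d =
    M%:Z * int_of_Z (last 0%ZZ p) + int_of_Z (last 0%ZZ q).
  rewrite (nth_map (0%ZZ, 0%ZZ)) ?szz // nth_zip ?sp ?sq //.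
  by rewrite /f /= -!nth_last sp sq.
(* The top coefficients of [p] and [q] are positive integers, so that of the pencil exceeds [M];
   this yields both the degree and the growth of the height. *)
have fd_ge M : (M < `|(nth 0 [seq f M c | c <- zip p q] d)%R|)%N.
  by rewrite fd; nia.
pose B := \max_(c <- zip p q) (`|int_of_Z c.1| + `|int_of_Z c.2|)%N.
have [M0 M0K] : exists M0 : nat, K <= M0%:R.
  by exists (Num.bound K); rewrite ltW // archi_boundP // ltW.
apply: (@height_family R d (pencil p q) id B K M0.+1) => //.
- move=> M M1; rewrite /pencil (@PolyK _ 0) ?size_map //.
  rewrite -nth_last size_map szz /=; apply/eqP => h.
  by have := fd_ge M; rewrite /f h.
- move=> M; apply: leq_trans (coef_le_height _ d).
  by rewrite coef_Poly ltnW.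
- move=> M M1; apply/height_Poly_le/allP => _ /mapP[c cz ->].
  apply: (@leq_trans ((`|int_of_Z c.1| + `|int_of_Z c.2|) * M)).
    apply: (@leq_trans (M * `|int_of_Z c.1| + `|int_of_Z c.2|)).
      by rewrite -lez_nat PoszD PoszM !abszE (le_trans (ler_normD _ _)) ?normrM.
    by rewrite mulnDl mulnC leq_add2l leq_pmulr.
  by rewrite leq_mul2r /B (leq_bigmax_seq _ cz) ?orbT.
move=> M M0M; have M1 : (0 < M)%N by case: M M0M.
have M0' : 0 < M%:R :> R by rewrite ltr0n.
have [||alpha [beta [ra rb ab le_ab]]] := HK (M%:R^-1).
- by rewrite invr_gt0.
- by rewrite mulrC ler_pdivrMr // mul1r (le_trans M0K) // ler_nat ltnW.
exists alpha, beta; rewrite map_pencil // !rootZ ?pnatr_eq0 -?lt0n //.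
by split=> //; rewrite -exprVn.
Qed.

(** * Pell equations *)

(** [x + y sqrt D] is the [M]-th power of [a + b sqrt D]. *)
Fixpoint pell (a b D : nat) (M : nat) : nat * nat :=
  if M is M'.+1 then
    let: (x, y) := pell a b D M' in (a * x + D * b * y, b * x + a * y)%N
  else (1, 0)%N.

(** The norm [x^2 - D y^2] is multiplicative, and each step adds at least [b x >= 1] to [y]. *)
Lemma pellP (a b D M : nat) : (a ^ 2 = D * b ^ 2 + 1)%N -> (0 < b)%N ->
  let: (x, y) := pell a b D M in (x ^ 2 = D * y ^ 2 + 1 /\ M <= y)%N.
Proof.
move=> ab b0; elim: M => [|M] /=; first by rewrite muln0.
case: (pell _ _ _ _) => x y [xy My]; split.
  have -> : ((a * x + D * b * y) ^ 2 =
      a ^ 2 * x ^ 2 + D ^ 2 * b ^ 2 * y ^ 2 + 2 * (D * a * b * x * y))%N by ring.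
  have -> : (D * (b * x + a * y) ^ 2 =
      D * b ^ 2 * x ^ 2 + D * a ^ 2 * y ^ 2 + 2 * (D * a * b * x * y))%N by ring.
  by rewrite ab xy; ring.
have x0 : (0 < x)%N by case: x xy => //; rewrite addn1.
have a0 : (0 < a)%N by case: a ab => //; rewrite addn1.
by rewrite -add1n leq_add ?muln_gt0 ?b0 // (leq_trans My) // leq_pmull.
Qed.

Lemma map_intr_Poly (K : nzRingType) (s : seq int) :
  map_poly intr (Poly s) = Poly [seq c%:~R | c <- s] :> {poly K}.
Proof.
apply/polyP => i; rewrite coef_map !coef_Poly.
have [si|si] := ltnP i (size s); first by rewrite (nth_map 0).
by rewrite !nth_default ?size_map.
Qed.

(** * Degree 3 *)

(** Dividing by [X + p], where [- p] is a real root, leaves [a X^2 + b1 X + c1] with conjugate roots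
    of squared modulus [c1 / a]. Then [p^2 - c1 / a = delta / a], where [delta = x p - y] is
    [O(y^-3)] and [a] is of order [y]. *)
Lemma cubic_roots (R : rcfType) (x y a : R) (P : {poly R[i]}) :
  x ^+ 2 + 2 * x * y - 2 * y ^+ 2 = 1 -> 4 <= y -> 0 < x ->
  a = 8 * x - 4 * y ->
  (forall z, P.[z] = ((a%:C * z + x%:C) * z + y%:C) * z + (x + 4 * y)%:C)%C ->
  exists alpha beta : R[i],
    [/\ root P alpha, root P beta, modulus alpha != modulus beta
      & `|modulus alpha - modulus beta| <= y ^- 4].
Proof.
move=> xy y4 x0 aE PE.
have y_gt0 : 0 < y by lra.
(* [x / y] is close to [sqrt 3 - 1 = 0.732...], the positive root of [t^2 + 2 t - 2]. *)
have x_lo : 7 / 10 * y < x.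
  rewrite ltNge; apply/negP => h.
  have h1 := ler_wpM2l (ltW x0) h; have h2 := ler_wpM2r (ltW y_gt0) h.
  have h3 := mulr_gt0 y_gt0 y_gt0; lra.
have x_hi : x <= 3 / 4 * y.
  rewrite leNgt; apply/negP => h.
  have h0 : 4 * 4 <= y * y by rewrite ler_pM.
  have h1 := ler_wpM2l (ltW x0) (ltW h).
  have h2 : 3 / 4 * y * y < x * y by rewrite ltr_pM2r.
  lra.
have a_lo : 8 / 5 * y < a by rewrite aE; lra.
have a_hi : a <= 2 * y by rewrite aE; lra.
pose f : {poly R} := Poly [:: x + 4 * y; y; x; a].
have fE t : f.[t] = ((a * t + x) * t + y) * t + (x + 4 * y).
  by rewrite /f /= !horner_cons horner0; ring.
have x_neq0 : x != 0 by rewrite gt_eqF.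
have yx : y / x <= 3 / 2 by rewrite ler_pdivrMr //; lra.
have yx1 : 4 / 3 <= y / x by rewrite ler_pdivlMr //; lra.
have f_hi : 0 <= f.[- (y / x)].
  have -> : f.[- (y / x)] = (x ^+ 2 + 2 * x * y - 2 * y ^+ 2) ^+ 2 / x ^+ 3.
    by rewrite fE aE; field.
  by rewrite xy expr1n divr_ge0 // exprn_ge0 // ltW.
have f_lo : f.[- (7 / 4)] <= 0 by rewrite fE aE; lra.
have r2 : - (7 / 4) <= - (y / x) by lra.
have [|r /andP[r_lo r_hi] fr] := poly_ivt r2 (p := f); first by rewrite f_lo.
pose p := - r; have p_hi : p <= 7 / 4 by rewrite /p; lra.
have p_lo : y / x <= p by rewrite /p; lra.
have fp : ((a * p - x) * p + y) * p = x + 4 * y.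
  by move/rootP: fr; rewrite fE /p; lra.
pose u := x * p; pose delta := u - y.
have u_ge : y <= u by rewrite /u mulrC -ler_pdivrMr.
(* At [- y / x], [x ^+ 3] times the cubic is the square of the Pell form, hence 1; subtracting its
   value 0 at the root leaves a multiple of [u - y]. *)
have deltaE : delta * (a * (u ^+ 2 + u * y + y ^+ 2) - x ^+ 2 * u) = 1.
  transitivity ((x ^+ 2 + 2 * x * y - 2 * y ^+ 2) ^+ 2); last by rewrite xy expr1n.
  transitivity (x ^+ 3 * (((a * p - x) * p + y) * p - (x + 4 * y)) +
    (x ^+ 2 + 2 * x * y - 2 * y ^+ 2) ^+ 2); last by rewrite fp subrr mulr0 add0r.
  by rewrite /delta /u aE; ring.
have y3 : 0 < y ^+ 3 by rewrite exprn_gt0.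
have brk : 3 * y ^+ 3 <= a * (u ^+ 2 + u * y + y ^+ 2) - x ^+ 2 * u.
  have h1 : 8 / 5 * y * (u ^+ 2 + u * y + y ^+ 2) <=
      a * (u ^+ 2 + u * y + y ^+ 2).
    by rewrite ler_wpM2r ?(ltW a_lo) // ?addr_ge0 ?sqr_ge0 // mulr_ge0 //; lra.
  have h2 : x ^+ 2 * u <= y ^+ 2 * u by rewrite ler_wpM2r //; [lra | nra].
  have h3 : y * y ^+ 2 <= y * (u ^+ 2) by rewrite ler_wpM2l //; [lra | nra].
  have h4 : y * y * y <= y * y * u by rewrite ler_wpM2l //; nra.
  lra.
have d_gt0 : 0 < delta.
  rewrite ltNge; apply/negP => d0; nra.
have d_hi : delta * (3 * y ^+ 3) <= 1.
  by have := ler_wpM2l (ltW d_gt0) brk; rewrite deltaE.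
pose b1 := x - a * p; pose c1 := y - p * b1.
have pc1 : p * c1 = x + 4 * y by rewrite /c1 /b1; lra.
have a_gt0 : 0 < a by lra.
have c_lo : 5 / 2 * y <= c1.
  rewrite leNgt; apply/negP => h.
  have h1 : p * c1 <= p * (5 / 2 * y) by rewrite ler_wpM2l ?(ltW h) //; lra.
  have h2 : p * y <= 7 / 4 * y by rewrite ler_wpM2r ?(ltW y_gt0).
  lra.
(* The discriminant is negative: [b1^2 <= 9 y^2], whereas [4 a c1 >= 16 y^2]. *)
have disc : (- b1 / a) ^+ 2 <= 4 * (c1 / a).
  have ap_lo : 8 / 5 * y <= a * p.
    by apply: le_trans (ltW a_lo) _; rewrite ler_peMr //; lra.
  have ap_hi : a * p <= 2 * y * (7 / 4) by rewrite ler_pM //; lra.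
  have b1_sq : b1 ^+ 2 <= (3 * y) ^+ 2.
    by rewrite -sqrrN ler_sqr ?nnegrE /b1; lra.
  have ac : 8 / 5 * y * (5 / 2 * y) <= a * c1 by rewrite ler_pM //; lra.
  have y2 : 0 < y ^+ 2 by rewrite exprn_gt0.
  rewrite expr_div_n sqrrN ler_pdivrMr ?exprn_gt0 //.
  by rewrite [leRHS](_ : _ = 4 * (a * c1)); [lra | field; rewrite gt_eqF].
have [z [zD zM]] := conj_pair disc.
have zq : modulus z = Num.sqrt (c1 / a).
  have <- : modulus z ^+ 2 = c1 / a.
    by apply: complexI; rewrite rmorphXn /= -modulusE sqr_normc.
  by rewrite sqrtr_sqr ger0_norm ?modulus_ge0.
have q2 : modulus z ^+ 2 = c1 / a by rewrite zq sqr_sqrtr // divr_ge0 ?ltW //; lra.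
have pq : p ^+ 2 - modulus z ^+ 2 = delta / a.
  by rewrite q2 /delta /u /c1 /b1; field; rewrite gt_eqF.
have dE : (p - modulus z) * (p + modulus z) = delta / a by rewrite -subr_sqr.
have da_gt0 : 0 < delta / a by rewrite divr_gt0.
have z_ge0 := modulus_ge0 z.
exists (- p)%:C%C, z; rewrite modulus_real normrN ger0_norm; last by lra.
split.
- rewrite /root PE -!(rmorphM, rmorphD) /=.
  by apply/eqP; congr (_%:C)%C; lra.
- have aC : a%:C%C != 0 :> R[i] by rewrite fmorph_eq0 gt_eqF.
  have b1C : (b1%:C = - a%:C * (z + z^*))%C.
    by rewrite zD -rmorphN -rmorphM; congr (_%:C)%C; field; rewrite gt_eqF.
  have c1C : (c1%:C = a%:C * (z * z^*))%C.
    by rewrite zM -rmorphM; congr (_%:C)%C; field; rewrite gt_eqF.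
  have xC : (x%:C = b1%:C + a%:C * p%:C)%C.
    by rewrite -rmorphM -rmorphD; congr (_%:C)%C; rewrite /b1; lra.
  have yC : (y%:C = c1%:C + p%:C * b1%:C)%C.
    by rewrite -rmorphM -rmorphD; congr (_%:C)%C; rewrite /c1; lra.
  by rewrite /root PE -pc1 rmorphM yC xC /= b1C c1C; apply/eqP; ring.
- by apply/eqP => h; move: dE; rewrite h subrr mul0r; lra.
have pz0 : 0 <= p - modulus z by nra.
rewrite ger0_norm //.
apply: (@le_trans _ _ (delta / a)); first by rewrite -dE ler_peMr //; lra.
rewrite ler_pdivrMr // mulrC ler_pdivlMr ?exprn_gt0 //.
have := ler_wpM2l (ltW y_gt0) d_hi; lra.
Qed.

Lemma cubic_family (R : realType) :
  close_moduli_family R 3.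
Proof.
(* [x^2 + 2 x y - 2 y^2 = (x + y)^2 - 3 y^2], so [(x + y, y)] runs through the powers of
   [2 + sqrt 3]; the truncated subtraction is exact. *)
pose y M : nat := (pell 2 1 3 M).2; pose x M : nat := ((pell 2 1 3 M).1 - y M)%N.
pose P M : {poly int} :=
  Poly [:: (x M + 4 * y M)%:Z; (y M)%:Z; (x M)%:Z; 8 * (x M)%:Z - 4 * (y M)%:Z].
have xyM M : (x M ^ 2 + 2 * x M * y M = 2 * y M ^ 2 + 1)%N /\ (M <= y M)%N.
  have := @pellP 2 1 3 M erefl isT; rewrite /x /y.
  case: (pell _ _ _ _) => /= X Y [XY MY]; split=> //.
  have YX : (Y <= X)%N by nia.
  by rewrite -{2 3}(subnK YX) in XY *; nia.
have x_gt0 M : (0 < x M)%N.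
  by have [+ _] := xyM M; case: (x M) => //; nia.
have a_gt0 M : (y M < 2 * x M)%N by have [] := xyM M; have := x_gt0 M; nia.
have x_le M : (x M <= y M + 1)%N by have [] := xyM M; nia.
apply: (@height_family R 3 P y 12 1 4) => //.
- move=> M M1; rewrite /P (@PolyK _ 0) //=; apply/eqP.
  by have := a_gt0 M; lia.
- move=> M; apply: leq_trans (coef_le_height _ 1).
  by rewrite coef_Poly /=; have [] := xyM M.
- move=> M M1; apply: height_Poly_le => /=.
  have := x_le M; have := a_gt0 M; have := xyM M; have := x_gt0 M; lia.
move=> M M4; rewrite mul1r.
have [xyE yM] := xyM M.
apply: (@cubic_roots R (x M)%:R (y M)%:R _ _ _ _ _ erefl).
- have := congr1 (fun n => n%:R : R) xyE; rewrite !natrD !natrM => h.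
  lra.
- by rewrite ler_nat (leq_trans M4).
- by rewrite ltr0n.
move=> z; rewrite map_intr_Poly /= !horner_cons horner0.
rewrite !(rmorphD, rmorphB, rmorphM, rmorph_nat, rmorphN) /=.
ring.
Qed.

(** * Degree 5 *)

Lemma quintic_family (R : realType) :
  close_moduli_family R 5.
Proof.
(* With [x = (1 + 27 e) sqrt 2 y], the value of [P M] at [z / sqrt 2] is
   [sqrt 2 y / 4] times [z^5 + 4 z^3 + 8 z - (1 + 27 e) (z^4 + 8 z^2 + 32)],
   which is [(z^3 - 8) (z^2 - z + 4)] at [e = 0]; the factor 27 makes the
   coefficients of the series below integral. *)
pose Q := [:: [:: -32; -864]; [:: 8]; [:: -8; -216]; [:: 4]; [:: -1; -27];
              [:: 1]]%ZZ.
(* The series continue [z^2 + 2 z + 4], a factor of [z^3 - 8], and [z^2 - z + 4]. Order 3 suffices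
   because [e] is [O(y^-2)]. *)
have [|K K_gt0 HK] := @close_moduli R Q 3
  [:: -2; -6; 144; -2520]%ZZ [:: 4; 24; -252; 2304]%ZZ
  [:: 1; 3; 36; -1260]%ZZ [:: 4; 24; -252; 2880]%ZZ.
  by [].
pose x M : nat := (pell 3 2 2 M).1; pose y M : nat := (pell 3 2 2 M).2.
pose P M : {poly int} :=
  Poly [:: - (8 * x M)%N%:Z; (4 * y M)%N%:Z; - (4 * x M)%N%:Z; (4 * y M)%N%:Z;
           - (x M)%:Z; (2 * y M)%N%:Z].
have xyM M : (x M ^ 2 = 2 * y M ^ 2 + 1)%N /\ (M <= y M)%N.
  by have := @pellP 3 2 2 M erefl isT; rewrite /x /y; case: (pell _ _ _ _).
have [M0 M0K] : exists M0 : nat, K <= M0%:R.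
  by exists (Num.bound K); rewrite ltW // archi_boundP // ltW.
apply: (@height_family R 5 P y 16 K M0.+1) => //.
- move=> M M1; rewrite /P (@PolyK _ 0) //=; apply/eqP.
  by have [_] := xyM M; lia.
- move=> M; apply: leq_trans (coef_le_height _ 1).
  by rewrite coef_Poly /=; have [_] := xyM M; lia.
- move=> M M1; apply: height_Poly_le => /=.
  have [h1 h2] := xyM M; have h3 : (x M <= 2 * y M)%N by nia.
  by lia.
move=> M M0M; have [xyE yM] := xyM M.
have xyR : (x M)%:R ^+ 2 = 2 * (y M)%:R ^+ 2 + 1 :> R.
  by have := congr1 (fun n => n%:R : R) xyE; rewrite natrD natrM !natrX.
have y_ge1 : 1 <= (y M)%:R :> R by rewrite ler1n; lia.
have Ky : K <= (y M)%:R by rewrite (le_trans M0K) // ler_nat; lia.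
have x_ge0 : 0 <= (x M)%:R :> R by rewrite ler0n.
rewrite /P; move: (x M) (y M) => X Y in xyR y_ge1 Ky x_ge0 *.
move: xyR y_ge1 Ky x_ge0.
have XC : X%:R = (X%:R : R)%:C%C by rewrite rmorph_nat.
have YC : Y%:R = (Y%:R : R)%:C%C by rewrite rmorph_nat.
move: (X%:R : R) (Y%:R : R) XC YC => s t XC YC st t_ge1 Kt s_ge0.
pose r : R := Num.sqrt 2.
have r2 : r ^+ 2 = 2 by rewrite sqr_sqrtr.
have r_ge0 : 0 <= r by exact: sqrtr_ge0.
have r_ge1 : 1 <= r by nra.
have r_gt0 : 0 < r by lra.
pose u := r * t.
have u2 : u ^+ 2 = 2 * t ^+ 2 by rewrite exprMn r2.
have tu : t <= u by rewrite ler_peMl //; lra.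
have us : (s - u) * (s + u) = 1 by rewrite -subr_sqr st u2; ring.
have su : u < s by rewrite -subr_gt0; nra.
have u_gt0 : 0 < u by lra.
pose e := (s / u - 1) / 27.
have sE : s = u * (1 + 27 * e) by rewrite /e; field; rewrite gt_eqF.
have e_gt0 : 0 < e by rewrite divr_gt0 // subr_gt0 ltr_pdivlMr // mul1r.
(* [s - u = 1 / (s + u)] gives [e = 1 / (27 u (s + u))], and [t <= u < s]. *)
have et : e * t ^+ 2 <= 1.
  by nra.
have [|alpha [beta [ra rb ab le_ab]]] := HK e e_gt0.
  by apply: le_trans et; rewrite ler_wpM2l ?(ltW e_gt0) //; nra.
have Q_root z : root (specialize e Q) z ->
    root (map_poly intr (Poly [:: - (8 * X)%N%:Z; (4 * Y)%N%:Z; - (4 * X)%N%:Z;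
      (4 * Y)%N%:Z; - X%:Z; (2 * Y)%N%:Z])) (z / r%:C)%C.
  have rC : r%:C%C != 0 :> R[i] by rewrite fmorph_eq0 gt_eqF //; lra.
  have rC2 : r%:C%C ^+ 2 = 2 :> R[i] by rewrite -rmorphXn r2 rmorph_nat.
  move/rootP => Qz; set w := (z / _)%C.
  have {}Qz : t%:C%C * (specialize e Q).[r%:C%C * w] = 0.
    by rewrite (mulrC r%:C%C) /w divfK // Qz mulr0.
  have rC2' : 2 * r%:C%C != 0 :> R[i] by rewrite mulf_neq0 // pnatr_eq0.
  rewrite /root -(mulrI_eq0 _ (mulfI rC2')); apply/eqP.
  rewrite -[RHS]Qz map_intr_Poly /=.
  rewrite !horner_cons !horner0 !mul0r !add0r.
  have q1 : peval e [:: -1; -27]%ZZ = - (1 + 27 * e).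
    by rewrite /= -[zr R (-1)]/(- 1%:R : R) -[zr R (-27)]/(- 27%:R : R); ring.
  have q2 : peval e [:: -8; -216]%ZZ = - (8 * (1 + 27 * e)).
    by rewrite /= -[zr R (-8)]/(- 8%:R : R) -[zr R (-216)]/(- 216%:R : R); ring.
  have q3 : peval e [:: -32; -864]%ZZ = - (32 * (1 + 27 * e)).
    by rewrite /= -[zr R (-32)]/(- 32%:R : R) -[zr R (-864)]/(- 864%:R : R); ring.
  have q0 (c : Z) : peval e [:: c] = zr R c by rewrite /= mulr0 addr0.
  rewrite q1 q2 q3 !q0 -[zr R 1]/(1 : R) -[zr R 4]/(4%:R : R) -[zr R 8]/(8%:R : R).
  rewrite !rmorphN /= -!pmulrn !natrM XC YC sE /u.
  rewrite !(rmorphN, rmorphM, rmorph1, rmorph_nat) /=.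
  clear Qz; move: (r%:C)%C (t%:C)%C (1 + 27 * e)%:C%C rC2 w => rc tc E rC2 w.
  apply/eqP; rewrite -subr_eq0; apply/eqP.
  (* The two sides agree only modulo [rc ^+ 2 = 2]; the cofactor is given explicitly. *)
  transitivity ((2 - rc ^+ 2) * (tc * (rc * (rc ^+ 2 + 2) * w ^+ 5 +
    4 * rc * w ^+ 3 - E * (rc ^+ 2 * w ^+ 4 - 16)))); first by ring.
  by rewrite rC2 subrr mul0r.
exists (alpha / r%:C)%C, (beta / r%:C)%C.
have modr z : modulus (z / r%:C)%C = modulus z / r.
  rewrite /modulus Normc.normcM Normc.normcV -/(modulus _) -/(modulus r%:C%C).
  by rewrite modulus_real ger0_norm.
rewrite !modr -mulrBl; split; [exact: Q_root | exact: Q_root | |].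
  by rewrite (inj_eq (mulIf _)) // invr_eq0 gt_eqF //; lra.
rewrite normrM (ger0_norm (x := r^-1)) ?invr_ge0 //.
apply: (@le_trans _ _ (K * e ^+ 3)).
  rewrite ler_pdivrMr //; apply: le_trans le_ab _.
  by rewrite ler_peMr // mulr_ge0 ?exprn_ge0 // ltW.
rewrite ler_wpM2l ?(ltW K_gt0) // -[leRHS]div1r ler_pdivlMr ?exprn_gt0 //; last lra.
by rewrite (exprM t 2 3) -exprMn exprn_ile1 // mulr_ge0 ?sqr_ge0 // ltW.
Qed.

(** * Degrees 4 and 6 *)

(* Both approximants are power series in [e = 1 / M] truncated at order [d];
   the first one is the square of a linear factor, i.e. a real root. *)
Lemma quartic_family (R : realType) : close_moduli_family R 4.
Proof.
pose a := [:: 1; -2; 2; -14; 26; -174]%ZZ.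
(* [p = X^4 - 1]; [a] continues its root 1, the last two lists its factor [X^2 + 1]. The order
   conditions are decided by computation in [Z]. *)
apply: (@pencil_family R 4 [:: -1; 0; 0; 0; 1]%ZZ [:: 5; -2; 2; -2; 5]%ZZ
  (pscale 2%ZZ a) (pmul a a)
  [:: 0; 0; -4; 8; -84; 208]%ZZ [:: 1; -4; 8; -36; 112; -468]%ZZ) => //.
Qed.

(* [p = (X^4 - 1) (X^2 - 4 X + 1)]; the factor 4 of [q] makes the series
   integral. *)
Lemma sextic_family (R : realType) : close_moduli_family R 6.
Proof.
pose a := [:: 1; -2; 2; -8; 14; -40; 84; -112]%ZZ.
apply: (@pencil_family R 6 [:: -1; 4; -1; 0; 1; -4; 1]%ZZ
  [:: 4; -12; -4; 8; -4; -12; 4]%ZZ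
  (pscale 2%ZZ a) (pmul a a)
  [:: 0; 0; 4; -8; 52; -120; 616; -1456]%ZZ
  [:: 1; -4; 8; -24; 64; -168; 448; -816]%ZZ) => //.
Qed.

Theorem theorem2 (R : realType) (d : nat) (hd : d \in [:: 3; 4; 5; 6]%N) :
  exists (P : nat -> {poly int}) (C : R) (M0 : nat),
    [/\ forall M : nat, (1 <= M)%N -> size (P M) = d.+1,
        height (P M) @[M --> \oo] --> \oo,
        0 < C,
        (1 <= M0)%N
      & forall M : nat, (M0 <= M)%N ->
          exists alpha beta : R[i],
            [/\ root (map_poly intr (P M)) alpha,
                root (map_poly intr (P M)) beta,
                `|alpha| != `|beta|
              & `| `|alpha| - `|beta| |
                  <= (C * (height (P M))%:R ^- d.+1)%:C%C]].
Proof.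
move: hd; rewrite !inE => /or4P[] /eqP ->.
- exact: cubic_family.
- exact: quartic_family.
- exact: quintic_family.
- exact: sextic_family.
Qed.
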